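(* Let $\lambda,\mu>0$, $\varrho=\lambda/\mu$ and $N\in\mathbb N$. The asymptotic probability generating function $F(z)=\lim_{t\to+\infty}\mathbb E[z^{\mathcal N(t)}]$ of the number of particles in the multi-type Ehrenfest system is, for $z\in(0,1]$, $$F(z)=\frac{(1+\varrho z)^{2N}}{z^N(1+\varrho)^{2N}}\left[1+g(\varrho,N)\sum_{j=0}^{N-1}\binom{N}{j+1}\left(\frac{z-1}{1+\varrho z}\right)^{j+1}{}_2F_1\left(-N,j+1;j+2;\frac{\varrho(z-1)}{1+\varrho z}\right)\right],$$ where $$g(\varrho,N)=\frac{1}{{}_2F_1(-N,1;1+N;-\varrho)}.$$
   Context: Multi-type Ehrenfest model: let $N,d\in\mathbb N$, $D=\{1,\dots,d\}$, $\lambda,\mu>0$, and let $C=(c_{l,j})_{l,j\in D}$ be a stochastic matrix ($c_{l,j}\ge 0$, $\sum_{j}c_{l,j}=1$). The system is a continuous-time Markov chain with states $(k,j)$, $k\in\{1,\dots,N\}$, $j\in D$ ($k$ particles, all of type $j$), and the empty states $(0,l)$, $l\in D$ (no particle, the last particles in the system having been of type $l$). The only transitions are: $(k,j)\to(k-1,j)$ at rate $\mu(N+k)$ for $1\le k\le N$; $(k,j)\to(k+1,j)$ at rate $\lambda(N-k)$ for $1\le k\le N-1$; $(0,l)\to(1,j)$ at rate $c_{l,j}\lambda N$. At time $0$ the chain is in $(0,l_0)$ for a fixed $l_0\in D$. $\mathcal N(t)\in\{0,1,\dots,N\}$ denotes the number of particles (first coordinate) at time $t$. ${}_2F_1(a,b;c;z)=\sum_{n\ge0}\frac{(a)_n(b)_n}{(c)_n}\frac{z^n}{n!}$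 is the Gauss hypergeometric function (a finite sum when $a$ is a nonpositive integer), $(a)_n=a(a+1)\cdots(a+n-1)$. *)

(* Defs.v *)
From HB Require Import structures.
From mathcomp Require Import all_boot all_order all_algebra.
From mathcomp Require Import all_classical all_reals all_analysis.

Set Implicit Arguments.
Unset Strict Implicit.
Unset Printing Implicit Defensive.

Import Order.TTheory GRing.Theory Num.Theory.
Import numFieldNormedType.Exports.

Local Open Scope classical_set_scope.
Local Open Scope ring_scope.

Section Hypergeometric.
Variable R : realType.

Definition pochhammer (a : R) (n : nat) : R := \prod_(i < n) (a + i%:R).

Definition hyp2F1 (a b c z : R) : R :=
  limn (series (fun n => pochhammer a n * pochhammer b n / pochhammer c n
                         * (z ^+ n / n`!%:R))).

End Hypergeometric.

Section MarkovChain.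
Variables (R : realType) (S : finType).

Record transition_function (p : R -> S -> S -> R) : Prop := TransitionFunction {
  tf_ge0 : forall t x y, 0 <= t -> 0 <= p t x y;
  tf_sum1 : forall t x, 0 <= t -> \sum_(y : S) p t x y = 1;
  tf_0 : forall x y, p 0 x y = (x == y)%:R;
  tf_chapman_kolmogorov : forall s t x z, 0 <= s -> 0 <= t ->
    p (s + t) x z = \sum_(y : S) p s x y * p t y z
}.

(* [q x y] is read only for [x != y].  Since [S] is finite and the rows of [p]
   sum to 1, the off-diagonal limits force
   (p h x x - 1) / h --> - \sum_(y | y != x) q x y. *)
Definition has_rates (p : R -> S -> S -> R) (q : S -> S -> R) : Prop :=
  forall x y, x != y -> p h x y / h @[h --> 0^'+] --> q x y.

(* The time index ranges over [R], but only nonnegative times are constrained.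
   The Markov property is written multiplicatively, which avoids conditioning
   on null events:
   P(X_(t_0) = x_0, ..., X_(t_(n+1)) = x_(n+1))
     = P(X_(t_0) = x_0, ..., X_(t_n) = x_n) * p_(t_(n+1) - t_n)(x_n, x_(n+1)). *)
Definition markov_chain (disp : measure_display) (Omega : measurableType disp)
    (P : probability Omega R) (q : S -> S -> R) (x0 : S)
    (X : R -> Omega -> S) : Prop :=
  [/\ forall t x, 0 <= t -> measurable [set w | X t w = x],
      P [set w | X 0 w = x0] = 1%E
    & exists p : R -> S -> S -> R,
      [/\ transition_function p,
          has_rates p q
        & forall (n : nat) (t : nat -> R) (x : nat -> S),
            0 <= t 0%N -> {homo t : i j / (i <= j)%N >-> i <= j} ->
            P [set w | forall i, (i <= n.+1)%N -> X (t i) w = x i] =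
            (P [set w | forall i, (i <= n)%N -> X (t i) w = x i] *
             (p (t n.+1 - t n) (x n) (x n.+1))%:E)%E]].

End MarkovChain.

Definition stochastic_matrix (R : realType) (d : nat) (C : 'M[R]_d) : Prop :=
  (forall l j, 0 <= C l j) /\ (forall l, \sum_(j < d) C l j = 1).

(* [(k, j)] with [0 < k] is: k particles, all of type j; [(0, l)] is: no
   particle, the last ones having been of type l. *)
Definition ehrenfest_state (N d : nat) : finType := ('I_N.+1 * 'I_d)%type.

Section Ehrenfest.
Variables (R : realType) (N d : nat) (lambda mu : R) (C : 'M[R]_d).

Definition ehrenfest_rate (x y : ehrenfest_state N d) : R :=
  let: (k, l) := x in
  let: (m, j) := y in
  if (k == 0 :> nat)%N then
    if (m == 1 :> nat)%N then C l j * lambda * N%:R else 0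
  else if l != j then 0
  else if (k == m.+1 :> nat)%N then mu * (N%:R + k%:R)
  else if (m == k.+1 :> nat)%N then lambda * (N%:R - k%:R)
  else 0.

Definition ehrenfest_process (disp : measure_display)
    (Omega : measurableType disp) (P : probability Omega R) (l0 : 'I_d)
    (X : R -> Omega -> ehrenfest_state N d) : Prop :=
  markov_chain P ehrenfest_rate (ord0, l0) X.

Definition particles (Omega : Type) (X : R -> Omega -> ehrenfest_state N d)
  (t : R) (w : Omega) : nat := (X t w).1.

End Ehrenfest.

(* Main.v *)
Require Import Defs.
From HB Require Import structures.
From mathcomp Require Import all_boot all_order all_algebra.
From mathcomp Require Import all_classical all_reals all_analysis.
From mathcomp Require Import measurable_realfun.
From mathcomp Require Import ring lra zify.

Set Implicit Arguments.
Unset Strict Implicit.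
Unset Printing Implicit Defensive.

Import Order.TTheory GRing.Theory Num.Theory.
Import numFieldNormedType.Exports.

Local Open Scope classical_set_scope.
Local Open Scope ring_scope.

(* The number of particles is lumpable: whatever the types, it evolves as a
   birth-death chain, reversible with respect to the weights
   C(2N, N+k) rho^k.  The Kolmogorov forward equation makes the chi-square
   distance to equilibrium decay exponentially, by a Poincare inequality on the
   path {0, ..., N}.  With w = (z - 1)/(1 + rho z) one has
   1 + w = z(1 + rho)/(1 + rho z) and 1 - rho w = (1 + rho)/(1 + rho z), so the
   generating function of the weights turns into a polynomial in w whose
   derivative telescopes to C(2N, N) N (1 + w)^(N-1) (1 - rho w)^N; integrating
   it term by term yields the hypergeometric expression. *)

(** * Terminating hypergeometric sums and the stationary generating function *)

Lemma pochhammer_opp_nat (R : realType) (N n : nat) :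
  pochhammer (- N%:R : R) n = (-1) ^+ n * (N ^_ n)%:R.
Proof.
elim: n => [|n IHn]; first by rewrite /pochhammer big_ord0 expr0 ffactn0 mulr1.
rewrite /pochhammer big_ord_recr /= -/(pochhammer _ n) IHn ffactnSr exprSr.
have [nN|Nn] := leqP n N; first by rewrite natrM natrB//; ring.
by rewrite ffact_small// !natrM !mul0r mulr0 mul0r mulr0.
Qed.

Lemma pochhammer_nat (R : realType) (m n : nat) :
  pochhammer (m.+1%:R : R) n = (m + n)`!%:R / m`!%:R.
Proof.
have fne0 k : k`!%:R != 0 :> R by rewrite pnatr_eq0 -lt0n fact_gt0.
elim: n => [|n IHn]; first by rewrite /pochhammer big_ord0 addn0 divff.
rewrite /pochhammer big_ord_recr /= -/(pochhammer _ n) IHn addnS factS natrM.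
by rewrite -natrD addSn; ring.
Qed.

(** The factor [(-N)_n] vanishes for [n > N], so the partial sums are eventually constant; below
    that, [(-N)_n / n!] is a signed binomial coefficient. *)
Lemma hyp2F1_opp_nat (R : realType) (N : nat) (b c z : R) :
  hyp2F1 (- N%:R) b c z =
  \sum_(n < N.+1) 'C(N, n)%:R * (pochhammer b n / pochhammer c n) * (- z) ^+ n.
Proof.
apply: lim_near_cst; first exact: Rhausdorff.
exists N.+1 => // n /= Nn; rewrite /series /= (big_cat_nat (leq0n N.+1) Nn)/=.
rewrite big_mkord [X in _ + X]big_nat.
rewrite [X in _ + X]big1 => [|i /andP[Ni _]]; last first.
  by rewrite pochhammer_opp_nat ffact_small// mulr0 !mul0r.
rewrite addr0; apply: eq_bigr => i _.
rewrite pochhammer_opp_nat -bin_ffact natrM [(- z) ^+ _]exprNn.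
have : i`!%:R != 0 :> R by rewrite pnatr_eq0 -lt0n fact_gt0.
(* The inverse is made opaque because [pochhammer c i] may vanish for an arbitrary [c]. *)
by move: (pochhammer c i)^-1 => y i0; field.
Qed.

(** Up to a constant factor, the binomial law with [2 * N] trials and success odds [rho],
    conditioned on at least [N] successes and shifted by [N]. *)
Definition ehrenfest_weight (R : realType) (N : nat) (rho : R) (k : nat) : R :=
  'C(2 * N, N + k)%:R * rho ^+ k.

(** As ['C(2 * N, N)] is the weight of 0, the factor [g] of the theorem is thereby the stationary
    probability of having no particle. *)
Lemma hyp2F1_ehrenfest_weight (R : realType) (N : nat) (rho : R) :
  hyp2F1 (- N%:R) 1 (1 + N%:R) (- rho) =
  (\sum_(k < N.+1) ehrenfest_weight N rho k) / 'C(2 * N, N)%:R.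
Proof.
have fne0 k : k`!%:R != 0 :> R by rewrite pnatr_eq0 -lt0n fact_gt0.
have binne0 : 'C(2 * N, N)%:R != 0 :> R by rewrite pnatr_eq0 -lt0n bin_gt0; lia.
rewrite hyp2F1_opp_nat mulr_suml; apply: eq_bigr => -[k /= kN] _.
rewrite nat1r (pochhammer_nat R 0) pochhammer_nat add0n fact0 divr1 opprK.
rewrite /ehrenfest_weight [RHS]mulrAC; congr (_ * _).
have e1 := bin_fact (n := 2 * N) (m := N + k).
have e2 := bin_fact (n := 2 * N) (m := N).
have e3 := bin_fact (n := N) (m := k).
have {}e1 : 'C(2 * N, N + k)%:R * ((N + k)`!%:R * (N - k)`!%:R) =
    (2 * N)`!%:R :> R.
  by rewrite -!natrM -e1; [congr (_ * (_ * _`!))%:R; lia|lia].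
have {}e2 : 'C(2 * N, N)%:R * (N`!%:R * N`!%:R) = (2 * N)`!%:R :> R.
  by rewrite -!natrM -e2; [congr (_ * (_ * _`!))%:R; lia|lia].
have {}e3 : 'C(N, k)%:R * (k`!%:R * (N - k)`!%:R) = N`!%:R :> R.
  by rewrite -!natrM -e3.
apply: (mulIf binne0); rewrite divfK// invf_div.
apply: (mulIf (fne0 (N + k)%N)); apply: (mulIf (fne0 (N - k)%N)).
rewrite -[RHS]mulrA e1 -e2 -!e3.
by field; rewrite !fne0.
Qed.

(** Detailed balance between [k] and [k.+1], cleared of [mu]. It drives both the telescoping of the
    derivative and the reversibility; at [k = N] both sides are 0. *)
Lemma ehrenfest_weightS (R : realType) (N : nat) (rho : R) (k : nat) :
  (k <= N)%N ->
  ehrenfest_weight N rho k.+1 * (N + k).+1%:R =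
  ehrenfest_weight N rho k * rho * (N - k)%:R.
Proof.
move=> kN; rewrite /ehrenfest_weight addnS exprSr.
have : ('C(2 * N, (N + k).+1) * (N + k).+1 = 'C(2 * N, N + k) * (N - k))%N.
  have := mul_bin_left (2 * N) (N + k).
  by rewrite mulnC => ->; rewrite mulnC; congr (_ * _)%N; lia.
move/(congr1 (fun n => n%:R : R)); rewrite !natrM => e.
by rewrite mulrAC e; rewrite -!mulrA; congr (_ * _); rewrite mulrC mulrA.
Qed.

Lemma ehrenfest_weight_gt0 (R : realType) (N : nat) (rho : R) (k : nat) :
  0 < rho -> (k <= N)%N -> 0 < ehrenfest_weight N rho k.
Proof.
move=> rho0 kN; rewrite /ehrenfest_weight mulr_gt0 ?exprn_gt0//.
by rewrite ltr0n bin_gt0; lia.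
Qed.

Lemma deriv_inj_eval0 (R : numDomainType) (p q : {poly R}) :
  p^`() = q^`() -> p.[0] = q.[0] -> p = q.
Proof.
move=> dpq pq0; apply/polyP => -[|i]; first by rewrite -!horner_coef0.
have := congr1 (fun r : {poly R} => r`_i) dpq.
by rewrite !coef_deriv => /eqP; rewrite eqrMn2r// => /eqP.
Qed.

(* Both sides are antiderivatives of
   'C(2N, N) * N * (1 + X)^(N - 1) * (1 - rho X)^N; on the left-hand side the
   derivative telescopes. *)
Lemma ehrenfest_weight_poly (R : realType) (N : nat) (rho : R) :
  \sum_(0 <= k < N.+1) ehrenfest_weight N rho k *:
    ((1 + 'X) ^+ (N + k) * (1 - rho *: 'X) ^+ (N - k)) =
  (\sum_(k < N.+1) ehrenfest_weight N rho k)%:P +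
  'C(2 * N, N)%:R *: \sum_(j < N) 'C(N, j.+1)%:R *: ('X^(j.+1) *
     \sum_(n < N.+1) ('C(N, n)%:R * (j.+1%:R / (j.+1 + n)%:R) * (- rho) ^+ n)
        *: 'X^n) :> {poly R}.
Proof.
apply: deriv_inj_eval0; last first.
  rewrite big_mkord !hornerE !horner_sum [X in _ + _ * X]big1 => [|j _].
    rewrite mulr0 addr0; apply: eq_bigr => k _.
    by rewrite !hornerE /= subr0 !expr1n !mulr1.
  by rewrite !hornerE /= expr0n /= mulr0 mul0r.
(* [T k] comes from differentiating the power of [1 + 'X] in the [k]-th summand; differentiating the
   other power gives [- T k.+1], by [ehrenfest_weightS]. *)
pose T k : {poly R} := ehrenfest_weight N rho k *:
  (((1 + 'X) ^+ (N + k).-1 * (1 - rho *: 'X) ^+ (N - k)) *+ (N + k)).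
rewrite raddf_sum /=.
transitivity (\sum_(0 <= k < N.+1) (T k - T k.+1)).
  apply: eq_big_nat => k /andP[_ kN].
  rewrite derivZ derivM !deriv_exp derivD derivX derivC add0r mul1r.
  rewrite derivB derivC derivZ derivX sub0r scalerDr mulrnAl; congr (_ + _).
  rewrite /T addnS /= -subn1 -subnDA addn1.
  rewrite mulrnAr mulNr -scalerAl mul1r mulrN -scalerAr.
  move: (_ * _) => U; rewrite mulNrn scalerN; congr (- _).
  rewrite -(scaler_nat (N - k)) -(scaler_nat (N + k).+1) !scalerA.
  congr (_ *: _); rewrite ehrenfest_weightS -1?ltnS//.
  by move: (N - k)%:R => y; ring.
transitivity (T 0).
  under eq_bigr do rewrite -opprB.
  rewrite sumrN telescope_sumr// opprB.
  have w0 : ehrenfest_weight N rho N.+1 = 0.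
    by rewrite /ehrenfest_weight bin_small ?mul0r//; lia.
  by rewrite {2}/T w0 scale0r subr0.
rewrite {1}/T subn0 addn0 /ehrenfest_weight addn0 expr0 mulr1.
rewrite derivD derivC add0r derivZ raddf_sum /=.
(* Differentiating ['X^(j.+1 + n)] cancels the denominator [j.+1 + n], and what remains is the
   binomial expansion of [(1 - rho *: 'X) ^+ N]. *)
have coefS (j : 'I_N) : ('C(N, j.+1)%:R *: ('X^(j.+1) * \sum_(n < N.+1)
    ('C(N, n)%:R * (j.+1%:R / (j.+1 + n)%:R) * (- rho) ^+ n) *: 'X^n))^`() =
    ('C(N, j.+1)%:R * j.+1%:R) *: 'X^j * (1 - rho *: 'X) ^+ N :> {poly R}.
  rewrite derivZ -scalerA -scalerAl; congr (_ *: _).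
  rewrite mulr_sumr raddf_sum /= -scalerAl exprDn mulr_sumr scaler_sumr.
  apply: eq_bigr => -[n /= nN] _.
  rewrite -scalerAr -exprD derivZ derivXn addSn /=.
  rewrite -(scaler_nat (j + n).+1 'X^(j + n)) scalerA.
  rewrite expr1n mul1r -scaleNr exprZn -(scaler_nat 'C(N, n) (_ *: _)).
  rewrite -[X in _ = _ *: X]scalerAr -[X in _ = _ *: (_ *: X)]scalerAr.
  rewrite -exprD !scalerA.
  congr (_ *: _).
  have : (j.+1 + n)%:R != 0 :> R by rewrite pnatr_eq0.
  by rewrite addSn => jn0; field.
under [in RHS]eq_bigr do rewrite coefS.
rewrite -mulr_suml -mulrnAl; congr (_ *: (_ * _)).
(* What is left is [(j + 1) C(N, j + 1) = N C(N - 1, j)]; the case [N = 0] is apart because of the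
   predecessor. *)
clear; case: N => [|n] /=; first by rewrite mulr0n big_ord0.
rewrite exprDn -sumrMnl; apply: eq_bigr => i _.
rewrite expr1n mul1r -mulrnA -natrM scaler_nat; congr (_ *+ _).
by have := mul_bin_diag n.+1 i; rewrite /=; lia.
Qed.

(** The polynomial identity is evaluated at [w]. The exponents [N + k] and [N - k] add up to
    [2 * N], so each term is [z ^+ k] times one common factor, the inverse of the prefactor on the
    left. *)
Lemma ehrenfest_pgf (R : realType) (N : nat) (rho z : R) :
  0 < rho -> 0 < z ->
  (1 + rho * z) ^+ (2 * N) / (z ^+ N * (1 + rho) ^+ (2 * N)) *
   (1 + (hyp2F1 (- N%:R) 1 (1 + N%:R) (- rho))^-1 * \sum_(j < N)
      'C(N, j.+1)%:R * ((z - 1) / (1 + rho * z)) ^+ j.+1 *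
      hyp2F1 (- N%:R) j.+1%:R j.+2%:R (rho * (z - 1) / (1 + rho * z))) =
  (\sum_(k < N.+1) ehrenfest_weight N rho k * z ^+ k) /
  (\sum_(k < N.+1) ehrenfest_weight N rho k).
Proof.
move=> rho0 z0.
have fne0 k : k`!%:R != 0 :> R by rewrite pnatr_eq0 -lt0n fact_gt0.
have binne0 : 'C(2 * N, N)%:R != 0 :> R by rewrite pnatr_eq0 -lt0n bin_gt0; lia.
have d0 : 1 + rho * z != 0 by rewrite gt_eqF// addr_gt0// mulr_gt0.
have r0 : 1 + rho != 0 by rewrite gt_eqF// addr_gt0.
have zn0 : z != 0 by rewrite gt_eqF.
have W0 : \sum_(k < N.+1) ehrenfest_weight N rho k != 0.
  rewrite gt_eqF// (bigD1 ord0)//= ltr_wpDr ?ehrenfest_weight_gt0//.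
  rewrite sumr_ge0// => k _.
  by rewrite ltW// ehrenfest_weight_gt0// -ltnS.
rewrite -[rho * (z - 1) / _]mulrA.
have [w wE] : exists w, w = (z - 1) / (1 + rho * z) by eexists.
have w1 : 1 + w = z * (1 + rho) / (1 + rho * z) by rewrite wE; field.
have w2 : 1 - rho * w = (1 + rho) / (1 + rho * z) by rewrite wE; field.
rewrite -wE hyp2F1_ehrenfest_weight.
set W := \sum_(k < N.+1) ehrenfest_weight N rho k in W0 *.
set S := \sum_(j < N) _; set G := \sum_(k < N.+1) _.
have : z ^+ N * (1 + rho) ^+ (2 * N) / (1 + rho * z) ^+ (2 * N) * G =
    W + 'C(2 * N, N)%:R * S.
  have := congr1 (horner^~ w) (ehrenfest_weight_poly N rho).
  rewrite big_mkord hornerD hornerC hornerZ !horner_sum -/W => H.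
  transitivity (\sum_(k < N.+1) (ehrenfest_weight N rho k *:
      ((1 + 'X) ^+ (N + k) * (1 - rho *: 'X) ^+ (N - k))).[w]).
    rewrite mulr_sumr; apply: eq_bigr => -[k /= kN] _.
    move: (ehrenfest_weight N rho k) => c.
    rewrite !hornerE /= w1 w2 !exprMn !exprVn.
    rewrite (_ : 2 * N = N + k + (N - k))%N; last by lia.
    rewrite !exprD.
    move: (N - k)%N => m; field.
    by rewrite !expf_neq0.
  rewrite H; congr (_ + _ * _); apply: eq_bigr => -[j /= jN] _.
  rewrite hornerZ hornerM hornerXn -mulrA; congr (_ * (_ * _)).
  rewrite hyp2F1_opp_nat horner_sum; apply: eq_bigr => -[n /= nN] _.
  rewrite hornerZ hornerXn !pochhammer_nat.
  rewrite -[- (rho * w)]mulNr exprMn [RHS]mulrA.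
  congr (_ * _ * _ * _).
  (* Here [(j + 1)_n / (j + 2)_n] collapses to [(j + 1) / (j + 1 + n)]. *)
  rewrite addSn factS natrM [j.+1`!]factS natrM.
  have j1 : j.+1%:R != 0 :> R by rewrite pnatr_eq0.
  have jn1 : (j + n).+1%:R != 0 :> R by rewrite pnatr_eq0.
  move: j1 jn1 (fne0 j) (fne0 (j + n)%N).
  move: j.+1%:R (j + n).+1%:R j`!%:R (j + n)`!%:R => x1 x2 x3 x4 h1 h2 h3 h4.
  by field; rewrite ?h1 ?h2 ?h3 ?h4.
move: (expf_neq0 (2 * N) d0) (expf_neq0 (2 * N) r0) (expf_neq0 N zn0).
move: (_ ^+ _) (_ ^+ _) (_ ^+ _) => a b c.
move=> c0 b0 a0 e.
have -> : S = (a * b / c * G - W) / 'C(2 * N, N)%:R by rewrite e; field.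
move: binne0; move: ('C(2 * N, N)%:R : R) => y y0.
by field; rewrite ?a0 ?b0 ?c0 ?W0 ?y0.
Qed.

(** * The Kolmogorov forward equation on a finite state space *)

Section ForwardEquation.
Variables (R : realType) (S : finType) (p : R -> S -> S -> R) (q : S -> S -> R).
Hypotheses (tf_p : transition_function p) (rates_p : has_rates p q).

(** Written with differences, so that only the off-diagonal rates, those fixed by [has_rates],
    enter. *)
Definition generator (f : S -> R) (x : S) : R :=
  \sum_(y : S) q x y * (f y - f x).

(** Chapman-Kolmogorov at the intermediate time [s]; rows summing to 1 let [f y] move under the
    inner sum. Taking [s] to be [t] or [t - h] gives the right and left increments at [t]. *)
Lemma transition_increment (s h : R) (x : S) (f : S -> R) :
  0 <= s -> 0 <= h ->
  \sum_y p (s + h) x y * f y - \sum_y p s x y * f y =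
  \sum_y p s x y * \sum_z p h y z * (f z - f y).
Proof.
move=> s0 h0.
under eq_bigr do rewrite (tf_chapman_kolmogorov tf_p)// mulr_suml.
rewrite exchange_big /= -sumrB; apply: eq_bigr => y _.
under [in RHS]eq_bigr do rewrite mulrBr.
rewrite sumrB -mulr_suml (tf_sum1 tf_p)// mul1r mulrBr mulr_sumr.
by congr (_ - _); apply: eq_bigr => z _; rewrite mulrA.
Qed.

Lemma cvg_sumr (T I : Type) (F : set_system T) (r : seq I) (f : I -> T -> R)
    (a : I -> R) : Filter F -> (forall i, f i x @[x --> F] --> a i) ->
  \sum_(i <- r) f i x @[x --> F] --> \sum_(i <- r) a i.
Proof. by move=> FF fa; apply: cvg_big => //; exact: add_continuous. Qed.

Lemma cvg_generator (f : S -> R) (x : S) :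
  (\sum_y p h x y * (f y - f x)) / h @[h --> 0^'+] --> generator f x.
Proof.
under eq_fun do rewrite mulr_suml.
apply: cvg_sumr => y; have [<-|xy] := eqVneq x y.
  rewrite subrr mulr0; under eq_fun do rewrite mulr0 mul0r.
  exact: cvg_cst.
under eq_fun do rewrite mulrAC.
exact: cvgMl (rates_p xy).
Qed.

Lemma tf_le1 (t : R) (x y : S) : 0 <= t -> p t x y <= 1.
Proof.
move=> t0; rewrite -(tf_sum1 tf_p x t0) (bigD1 y)//= lerDl sumr_ge0// => z _.
exact: tf_ge0.
Qed.

(** The left difference quotient at [t] carries the moving weights [p (t - h)], whose limit is
    needed. *)
Lemma transition_left_continuous (t : R) (x y : S) : 0 < t ->
  p (t - h) x y @[h --> 0^'+] --> p t x y.
Proof.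
move=> t0; pose f z : R := (z == y)%:R.
have fE s : p s x y = \sum_z p s x z * f z.
  rewrite (bigD1 y)//= /f eqxx mulr1 big1 ?addr0// => z /negPf ->.
  by rewrite mulr0.
(* [D h] bounds the increment uniformly in the starting time, since all transition probabilities are
   at most 1. It tends to 0 because each term divided by [h] converges. *)
pose D h := \sum_z `|\sum_v p h z v * (f v - f z)|.
have D0 : D h @[h --> 0^'+] --> (0 : R).
  rewrite [X in _ --> X](_ : 0 = \sum_(z : S) 0); last by rewrite big1.
  apply: cvg_sumr => z.
  have h0 : h @[h --> (0:R)^'+] --> (0 : R).
    by apply: cvg_at_right_filter; exact: cvg_id.
  have H : `|(\sum_v p h z v * (f v - f z)) / h * h| @[h --> 0^'+] -->
      `|generator f z * 0|.
    by apply: cvg_norm; apply: cvgM; [exact: cvg_generator|exact: h0].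
  rewrite mulr0 normr0 in H.
  refine (cvg_trans _ H); apply: near_eq_cvg; near=> h.
  by rewrite /= divfK// gt_eqF//; near: h; exact: nbhs_right_gt.
apply: (@squeeze_cvgr _ _ _ _
  (fun h => p t x y - D h) (fun h => p t x y + D h)).
- near=> h; rewrite -ler_distl distrC.
  have h0 : 0 < h by near: h; exact: nbhs_right_gt.
  have ht : 0 <= t - h by rewrite subr_ge0; near: h; exact: nbhs_right_le.
  rewrite [in X in X <= _]fE (fE (t - h)) -{1}(subrK h t).
  rewrite transition_increment ?(ltW h0)//.
  apply: le_trans (ler_norm_sum _ _ _) _; apply: ler_sum => z _.
  rewrite normrM ler_piMl// ger0_norm ?tf_le1//.
  exact: tf_ge0.
- by rewrite -[X in _ --> X]subr0; apply: cvgB => //; exact: cvg_cst.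
- by rewrite -[X in _ --> X]addr0; apply: cvgD => //; exact: cvg_cst.
Unshelve. all: by end_near. Qed.

(** The one-sided quotients are treated separately: the weights are frozen at [p t] on the right,
    and are [p (t - h)] on the left, where left continuity applies. *)
Lemma forward_equation (f : S -> R) (t : R) (x : S) : 0 < t ->
  is_derive t 1 (fun s => \sum_y p s x y * f y)
    (\sum_y p t x y * generator f y).
Proof.
move=> t0; set phi := fun s => _.
suff H : h^-1 *: ((phi \o shift t) (h *: 1) - phi t) @[h --> 0^'] -->
    \sum_y p t x y * generator f y.
  by apply: DeriveDef; [apply/cvg_ex; eexists; exact: H|exact: cvg_lim H].
have twosided := @cvg_at_right_left_dnbhs R R^o
  (fun h => h^-1 *: ((phi \o shift t) (h *: 1) - phi t)) 0
  (\sum_y p t x y * generator f y).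
apply: twosided.
  have H : \sum_y p t x y * ((\sum_z p h y z * (f z - f y)) / h)
      @[h --> 0^'+] -->
      \sum_y p t x y * generator f y.
    by apply: cvg_sumr => y; apply: cvgMr; exact: cvg_generator.
  refine (cvg_trans _ H); apply: near_eq_cvg; near=> h.
  have h0 : 0 < h by near: h; exact: nbhs_right_gt.
  rewrite /= [h%:A]mulr1 [h + t]addrC /phi.
  rewrite transition_increment ?(ltW h0) ?(ltW t0)//.
  rewrite scaler_sumr; apply: eq_bigr => y _; rewrite /GRing.scale /=; ring.
apply/cvg_at_leftNP; rewrite oppr0.
have H : \sum_y p (t - h) x y * ((\sum_z p h y z * (f z - f y)) / h)
    @[h --> 0^'+] -->
    \sum_y p t x y * generator f y.
  apply: cvg_sumr => y; apply: cvgM; last exact: cvg_generator.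
  exact: transition_left_continuous.
refine (cvg_trans _ H); apply: near_eq_cvg; near=> h.
have h0 : 0 < h by near: h; exact: nbhs_right_gt.
have ht : 0 <= t - h by rewrite subr_ge0; near: h; exact: nbhs_right_le.
rewrite /= [(- h)%:A]mulr1 invrN scaleNr -scalerN opprB [- h + t]addrC.
rewrite (_ : phi t = phi (t - h + h)); last by rewrite subrK.
rewrite /phi (transition_increment _ _ ht (ltW h0)).
rewrite scaler_sumr; apply: eq_bigr => y _; rewrite /GRing.scale /=; ring.
Unshelve. all: by end_near. Qed.

End ForwardEquation.

(** * Exponential convergence of reversible chains on a path *)

(** Going along the path from 0 to [i], each [(h i - h ord0) ^+ 2] is bounded by a multiple of the
    Dirichlet form, with a factor independent of [h]; these bounds are then averaged against [w]. *)
Lemma poincare_path (R : realType) (n : nat) (w : 'I_n.+1 -> R)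
    (s : 'I_n.+1 -> 'I_n.+1 -> R) :
  (forall i, 0 <= w i) -> (forall i j, 0 <= s i j) ->
  (forall i j : 'I_n.+1, j = i.+1 :> nat -> 0 < s i j) ->
  exists2 c, 0 < c & forall h : 'I_n.+1 -> R, \sum_i w i * h i = 0 ->
    c * (\sum_i w i * h i ^+ 2) <= \sum_i \sum_j s i j * (h j - h i) ^+ 2.
Proof.
move=> w0 s0 sS.
pose E (h : 'I_n.+1 -> R) := \sum_i \sum_j s i j * (h j - h i) ^+ 2.
have sE h i j : s i j * (h j - h i) ^+ 2 <= E h.
  rewrite /E (bigD1 i)//= (bigD1 j)//= -addrA lerDl addr_ge0//.
    by apply: sumr_ge0 => k _; rewrite mulr_ge0// sqr_ge0.
  by apply: sumr_ge0 => k _; apply: sumr_ge0 => l _; rewrite mulr_ge0// sqr_ge0.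
have E0 h : 0 <= E h.
  by apply: sumr_ge0 => k _; apply: sumr_ge0 => l _; rewrite mulr_ge0// sqr_ge0.
have /fin_all_exists2[K K0 KE] (i : 'I_n.+1) :
    exists2 K, 0 <= K & forall h, (h i - h ord0) ^+ 2 <= K * E h.
  case: i => i; elim: i => [|i IHi] ilt.
    exists 0 => // h; rewrite (_ : Ordinal ilt = ord0) ?subrr ?expr0n ?mul0r//.
    exact: val_inj.
  have [K K0 KE] := IHi (ltnW ilt).
  set i0 := Ordinal (ltnW ilt); set i1 := Ordinal ilt.
  have s01 : 0 < s i0 i1 by apply: sS.
  (* From [(a + b)^2 <= 2 a^2 + 2 b^2], with [b] the jump over the last edge. *)
  exists (2 * K + 2 / s i0 i1) => [|h].
    by rewrite addr_ge0 ?mulr_ge0// invr_ge0 ltW.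
  have h1 := KE h.
  have h2 : (h i1 - h i0) ^+ 2 <= E h / s i0 i1.
    by rewrite ler_pdivlMr// mulrC.
  have h3 : 0 <= (h i1 - h i0 - (h i0 - h ord0)) ^+ 2 by rewrite sqr_ge0.
  rewrite mulrDl -!mulrA (mulrC (_^-1)); move: h1 h2 h3; rewrite -/i0.
  move: (E h / _) (K * _) => A B; rewrite !expr2; lra.
pose M := \sum_i w i * K i.
have M0 : 0 <= M by apply: sumr_ge0 => i _; rewrite mulr_ge0.
have M1 : 0 < 1 + M by rewrite ltr_wpDr.
(* Adding 1 keeps the constant well defined when [M = 0]. *)
exists (1 + M)^-1 => [|h wh0]; first by rewrite invr_gt0.
rewrite mulrC ler_pdivrMr// -/(E h).
(* The mean minimizes the mean square deviation. *)
apply: (@le_trans _ _ (\sum_i w i * (h i - h ord0) ^+ 2)).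
  have -> : \sum_i w i * (h i - h ord0) ^+ 2 =
      \sum_i w i * h i ^+ 2 - 2 * h ord0 * (\sum_i w i * h i) +
      h ord0 ^+ 2 * \sum_i w i.
    rewrite !mulr_sumr -sumrB -big_split /=; apply: eq_bigr => i _; ring.
  by rewrite wh0 mulr0 subr0 lerDl mulr_ge0 ?sqr_ge0// sumr_ge0.
apply: (@le_trans _ _ (M * E h)); last by rewrite mulrC ler_wpM2l// lerDr.
rewrite mulr_suml; apply: ler_sum => i _.
by rewrite -mulrA ler_wpM2l.
Qed.

(** [V t * expR (c * t)] is nonincreasing. The comparison starts at time 1, as the assumptions hold
    only at positive times. *)
Lemma gronwall_cvg0 (R : realType) (V dV : R -> R) (c : R) : 0 < c ->
  (forall t, 0 < t -> 0 <= V t) ->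
  (forall t : R, 0 < t -> is_derive t 1 V (dV t)) ->
  (forall t, 0 < t -> dV t <= - (c * V t)) ->
  V t @[t --> +oo] --> 0.
Proof.
move=> c0 V0 VdV dVle; pose G t := V t * expR (c * t).
have GdG (t : R) : 0 < t -> is_derive t 1 G ((dV t + c * V t) * expR (c * t)).
  move=> t0; have := VdV t t0 => dVt.
  have de : is_derive t 1 (fun t => expR (c * t)) (expR (c * t) * c).
    apply: (@is_derive1_comp _ expR (fun t => c * t)).
    apply: (is_derive_eq (is_deriveZ c (is_derive_id t (1 : R)))).
    by rewrite [LHS]mulr1.
  apply: (is_derive_eq (is_deriveM dVt de)).
  rewrite /GRing.scale /=; ring.
have GV t : V t = G t * expR (- (c * t)).
  by rewrite /G -mulrA -expRD subrr expR0 mulr1.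
have Gdec (t : R) : 1 <= t -> G t <= G 1.
  move=> t1; apply: (@ler0_derive1_le_cc _ G 1 t) => //.
  - move=> x; rewrite in_itv /= => /andP[x1 _].
    by have [] := GdG x (lt_trans ltr01 x1).
  - move=> x; rewrite in_itv /= => /andP[x1 _].
    have x0 := lt_trans ltr01 x1; have [_ dG] := GdG x x0.
    rewrite derive1E dG mulr_le0_ge0 ?expR_ge0//.
    by have := dVle x x0; lra.
  - apply: continuous_in_subspaceT => x; rewrite inE/= in_itv /= => /andP[x1 _].
    apply/differentiable_continuous/derivable1_diffP.
    by have [] := GdG x (lt_le_trans ltr01 x1).
  - by rewrite in_itv /= lexx t1.
  - by rewrite in_itv /= lexx t1.
apply: (@squeeze_cvgr _ _ _ _ (fun=> 0) (fun t => G 1 * expR (- (c * t)))).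
- near=> t; have t1 : 1 <= t by near: t; exact: nbhs_pinfty_ge.
  rewrite V0 ?(lt_le_trans ltr01)//= GV ler_wpM2r ?expR_ge0//.
  exact: Gdec.
- exact: cvg_cst.
- rewrite -[X in _ --> X](mulr0 (G 1)); apply: cvgMr.
  have ct : c * t @[t --> +oo] --> +oo by apply: gt0_cvgMry.
  exact: (cvg_comp _ _ ct (@cvgr_expR R)).
Unshelve. all: by end_near. Qed.

(* The chi-square distance to equilibrium, sum of w h^2 with h = u / w - 1 / W,
   is a Lyapunov function: by reversibility its derivative is minus the
   Dirichlet form of h. *)
Lemma reversible_cvg (R : realType) (n : nat) (r : 'I_n.+1 -> 'I_n.+1 -> R)
    (w : 'I_n.+1 -> R) (u : R -> 'I_n.+1 -> R) :
  (forall i, 0 < w i) -> (forall i j, 0 <= r i j) ->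
  (forall i j : 'I_n.+1, j = i.+1 :> nat -> 0 < r i j) ->
  (forall i j, w i * r i j = w j * r j i) ->
  (forall t, 0 < t -> \sum_i u t i = 1) ->
  (forall (t : R) k, 0 < t -> is_derive t 1 (u ^~ k)
     (\sum_i u t i * \sum_j r i j * ((j == k)%:R - (i == k)%:R))) ->
  forall k, u t k @[t --> +oo] --> w k / \sum_i w i.
Proof.
move=> w0 r0 rS rev u1 ud k0.
set W := \sum_i w i.
have W0 : 0 < W.
  by rewrite /W (bigD1 ord0)//= ltr_wpDr// sumr_ge0// => i _; exact: ltW.
pose h t i := (w i)^-1 * u t i - W^-1.
have uh t i : u t i = w i * (h t i + W^-1).
  by rewrite /h subrK mulVKf// gt_eqF.
have wh t : 0 < t -> \sum_i w i * h t i = 0.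
  move=> t0; have := u1 t t0; under eq_bigr do rewrite uh mulrDr.
  rewrite big_split /= -mulr_suml divff ?gt_eqF// => e.
  by apply: (addIr 1); rewrite add0r.
have [|||c c0 gap] := @poincare_path R n w (fun i j => w i * r i j).
- by move=> i; exact: ltW.
- by move=> i j; rewrite mulr_ge0// ltW.
- by move=> i j ij; rewrite mulr_gt0// rS.
pose V t := \sum_i w i * h t i ^+ 2.
pose E t := \sum_i \sum_j w i * r i j * (h t j - h t i) ^+ 2.
have V0 t : 0 <= V t.
  by apply: sumr_ge0 => i _; rewrite mulr_ge0 ?sqr_ge0// ltW.
have VdV (t : R) : 0 < t -> is_derive t 1 V (- E t).
  move=> t0.
  pose du k := \sum_i u t i * \sum_j r i j * ((j == k)%:R - (i == k)%:R).
  have dV : is_derive t 1 V (\sum_k 2 * h t k * du k).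
    rewrite (_ : V = \sum_k (fun t => w k * h t k ^+ 2)); last first.
      by apply/funext => s; rewrite fct_sumE.
    apply: is_derive_sum => k.
    have duk := ud t k t0; rewrite -/(du k) in duk.
    have dh : is_derive t 1 (h ^~ k) (du k / w k).
      apply: (is_derive_eq
        (is_deriveB (is_deriveZ (w k)^-1 duk) (is_derive_cst W^-1 t 1))).
      by rewrite subr0 /GRing.scale /= mulrC.
    apply: (is_derive_eq (is_deriveZ (w k) (is_deriveX 2 dh))).
    rewrite /GRing.scale /= expr1; have := w0 k => wk0.
    by field; rewrite gt_eqF.
  apply: is_derive_eq dV _.
  have -> : \sum_k 2 * h t k * du k =
      2 * \sum_i \sum_j w i * r i j * ((h t i + W^-1) * (h t j - h t i)).
    under eq_bigr do rewrite -mulrA.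
    rewrite -mulr_sumr; congr (_ * _).
    under eq_bigr do rewrite /du mulr_sumr.
    rewrite exchange_big; apply: eq_bigr => i _ /=.
    under eq_bigr do rewrite mulrCA mulr_sumr.
    rewrite -mulr_sumr exchange_big /= mulr_sumr; apply: eq_bigr => j _.
    have delta (a : 'I_n.+1) : \sum_k h t k * (a == k)%:R = h t a.
      rewrite (bigD1 a)//= eqxx mulr1 big1 ?addr0// => k /negPf ka.
      by rewrite eq_sym ka mulr0.
    rewrite (_ : \sum_k _ = r i j * (h t j - h t i)) ?[u t i]uh; first by ring.
    rewrite -!delta -sumrB mulr_sumr; apply: eq_bigr => k _; ring.
  (* The factor 2 pairs [(i, j)] with [(j, i)]. By reversibility both carry the same coefficient,
     the constant [W^-1] cancels, and [- (h t j - h t i) ^+ 2] remains. *)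
  rewrite mulr_natl mulr2n [X in _ + X]exchange_big -big_split /= -sumrN.
  apply: eq_bigr => i _; rewrite -big_split /= -sumrN; apply: eq_bigr => j _.
  rewrite (rev j i); ring.
have Vcvg : V t @[t --> +oo] --> 0.
  apply: (gronwall_cvg0 c0) VdV _ => // t t0.
  by rewrite lerN2 gap// wh.
rewrite -[X in _ --> X]addr0.
rewrite (_ : u ^~ k0 = fun t => w k0 / W + w k0 * h t k0); last first.
  by apply/funext => t; rewrite uh mulrDr addrC.
apply: cvgD; first exact: cvg_cst.
apply/norm_cvg0P.
rewrite -[X in _ --> X]sqrtr0.
(* One term of [V] controls each coordinate: [(w h)^2 = w (w h^2) <= w V]. *)
apply: (@squeeze_cvgr _ _ _ _ (fun=> 0) (fun t => Num.sqrt (w k0 * V t))).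
- near=> t; rewrite normr_ge0/= -sqrtr_sqr ler_wsqrtr// exprMn expr2 -mulrA.
  rewrite ler_wpM2l ?(ltW (w0 _))// /V (bigD1 k0)//= lerDl sumr_ge0// => i _.
  by rewrite mulr_ge0 ?sqr_ge0// ltW.
- by rewrite sqrtr0; exact: cvg_cst.
- apply: continuous_cvg; first exact: sqrt_continuous.
  by rewrite -[X in _ --> X](mulr0 (w k0)); apply: cvgMr.
Unshelve. all: by end_near. Qed.

(** * Laws at a fixed time and expectations *)

(** The Markov property between times 0 and [t] gives the probability of [A] and [B] together; since
    [A] has probability 1, intersecting with it does not change that of [B]. *)
Lemma markov_chain_marginal (R : realType) (S : finType)
    (disp : measure_display) (Omega : measurableType disp)
    (P : probability Omega R) (q : S -> S -> R) (x0 : S) (X : R -> Omega -> S) :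
  markov_chain P q x0 X ->
  exists p : R -> S -> S -> R, [/\ transition_function p, has_rates p q &
    forall t y, 0 <= t -> P [set w | X t w = y] = (p t x0 y)%:E].
Proof.
move=> [mX PX0 [p [tf_p rates_p fdd]]]; exists p; split => // t y t0.
pose A := [set w | X 0 w = x0]; pose B := [set w | X t w = y].
have mA : measurable A by apply: mX.
have mB : measurable B by apply: mX.
(* The time sequence is 0, then constantly [t], which keeps it nondecreasing. *)
have := fdd 0 (fun i => if i is 0 then 0 else t)
  (fun i => if i is 0 then x0 else y).
rewrite subr0 (_ : [set w | _] = A `&` B); last first.
  apply/seteqP; split => w /=.
    by move=> h; split; [exact: (h 0)|exact: (h 1)].
  by move=> [? ?] [|[|]].
rewrite (_ : [set w | _] = A); last first.
  by apply/seteqP; split => w /=; [move=> h; exact: (h 0)|move=> ? [|]].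
rewrite PX0 mul1e => <- //; last by move=> [|i] [|j].
apply/eqP; rewrite eq_le; apply/andP; split; last first.
  by apply: le_measure; rewrite ?inE//; exact: measurableI.
have PC : P (~` A) = 0%E by rewrite probability_setC// PX0 subee.
apply: (@le_trans _ _ (P ((A `&` B) `|` ~` A))).
  apply: le_measure; rewrite ?inE//.
    by apply: measurableU; [exact: measurableI|exact: measurableC].
  by move=> w Bw; case: (pselect (A w)) => Aw; [left|right].
apply: (le_trans (measureU2 _ _ _)); [exact: measurableI|exact: measurableC|].
by rewrite [X in (_ + X)%E]PC adde0.
Qed.

Lemma expectation_finite (R : realType) (S : finType) (disp : measure_display)
    (Omega : measurableType disp) (P : probability Omega R) (Y : Omega -> S)
    (f : S -> R) :
  (forall y, measurable [set w | Y w = y]) -> (forall y, 0 <= f y) ->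
  ('E_P[fun w => f (Y w)])%E = (\sum_y (f y)%:E * P [set w | Y w = y])%E.
Proof.
move=> mY f0; rewrite unlock.
under eq_integral => w _.
  rewrite (_ : (f (Y w))%:E =
    (\sum_y (f y)%:E * (\1_[set w | Y w = y] w)%:E)%E); last first.
    rewrite (bigD1 (Y w))//= indicE mem_set//= mule1 big1 ?adde0// => y yw.
    by rewrite indicE memNset ?mule0//= => e; rewrite e eqxx in yw.
  over.
rewrite ge0_integral_sum//; last 2 first.
- move=> y; apply: measurable_funeM; apply/measurable_EFinP.
  exact: measurable_indic.
- by move=> y w _; rewrite mule_ge0 ?lee_fin.
apply: eq_bigr => y _.
rewrite ge0_integralZl_EFin//; last first.
  by apply/measurable_EFinP; exact: measurable_indic.
by rewrite integral_indic// setIT.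
Qed.

(** * Lumping the types: the number of particles as a birth-death chain *)

Lemma partition_big_fst (R : realType) (I J : finType) (a : I * J -> R)
    (F : I -> R) :
  \sum_y a y * F y.1 = \sum_i (\sum_y a y * (y.1 == i)%:R) * F i.
Proof.
under [RHS]eq_bigr do rewrite mulr_suml.
rewrite exchange_big /=; apply: eq_bigr => y _.
rewrite (bigD1 y.1)//= eqxx mulr1 big1 ?addr0// => i /negPf iy.
by rewrite eq_sym iy mulr0 mul0r.
Qed.

Definition particle_rate (R : realType) (N : nat) (lambda mu : R)
    (m k : 'I_N.+1) : R :=
  if k == m.+1 :> nat then lambda * (N - m)%:R
  else if m == k.+1 :> nat then mu * (N + m)%:R else 0.

(** From an empty state the target types sum out because the rows of [C] sum to 1; from a nonempty
    state only the current type can be reached. *)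
Lemma ehrenfest_rate_lump (R : realType) (N d : nat) (lambda mu : R)
    (C : 'M[R]_d) (x : ehrenfest_state N d) (F : 'I_N.+1 -> R) :
  stochastic_matrix C ->
  \sum_y ehrenfest_rate lambda mu C x y * F y.1 =
  \sum_k particle_rate lambda mu x.1 k * F k.
Proof.
case: x => m l [_ C1].
transitivity (\sum_k \sum_j ehrenfest_rate lambda mu C (m, l) (k, j) * F k).
  by rewrite pair_bigA; apply: eq_bigr; case.
apply: eq_bigr => k _; rewrite -mulr_suml; congr (_ * _).
rewrite /ehrenfest_rate /particle_rate.
have mN : (m <= N)%N by rewrite -ltnS.
have [m0|m0] := eqVneq (m : nat) 0%N.
  rewrite m0 subn0 /=.
  have [k1|k1] := eqVneq (k : nat) 1%N; last by rewrite big1.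
  by rewrite -!mulr_suml C1 mul1r.
rewrite (bigD1 l)//= eqxx /= big1 ?addr0; last first.
  by move=> j jl; rewrite eq_sym jl.
rewrite natrB// natrD.
case: (eqVneq (m : nat) k.+1) => [mk|_]; last by [].
by rewrite ifN// mk; lia.
Qed.

(** By symmetry [i <= j]; both sides vanish unless [j = i.+1], and then it is
    [ehrenfest_weightS]. *)
Lemma particle_rate_reversible (R : realType) (N : nat) (lambda mu : R)
    (i j : 'I_N.+1) : mu != 0 ->
  ehrenfest_weight N (lambda / mu) i * particle_rate lambda mu i j =
  ehrenfest_weight N (lambda / mu) j * particle_rate lambda mu j i.
Proof.
move=> mu0.
wlog ij : i j / (i <= j)%N => [sym|].
  by have [/sym//|/ltnW/sym ->] := leqP i j.
rewrite /particle_rate; have [ji|ji] := eqVneq (j : nat) i.+1; last first.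
  have -> : (i == j.+1 :> nat) = false by lia.
  by rewrite !mulr0.
rewrite ifN; last by lia.
have iN : (i <= N)%N by rewrite -ltnS.
have := ehrenfest_weightS (lambda / mu) iN.
rewrite ji addnS => e; rewrite [RHS]mulrCA e.
by move: (N - i)%:R => y; field.
Qed.

Lemma ehrenfest_particles_cvg (R : realType) (N d : nat) (lambda mu : R)
    (C : 'M[R]_d) (p : R -> ehrenfest_state N d -> ehrenfest_state N d -> R)
    (x : ehrenfest_state N d) (k : 'I_N.+1) :
  0 < lambda -> 0 < mu -> stochastic_matrix C -> transition_function p ->
  has_rates p (ehrenfest_rate lambda mu C) ->
  \sum_y p t x y * (y.1 == k)%:R @[t --> +oo] -->
  ehrenfest_weight N (lambda / mu) k /
    \sum_(i < N.+1) ehrenfest_weight N (lambda / mu) i.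
Proof.
move=> lambda0 mu0 CS tf_p rates_p.
have rho0 : 0 < lambda / mu by rewrite divr_gt0.
apply: (@reversible_cvg R N (particle_rate lambda mu)
  (fun i => ehrenfest_weight N (lambda / mu) i)
  (fun t i => \sum_y p t x y * (y.1 == i)%:R)).
- by move=> i; rewrite ehrenfest_weight_gt0// -ltnS.
- move=> i j; rewrite /particle_rate.
  have [l0 m0] := (ltW lambda0, ltW mu0).
  by do 2?[case: ifP => _]; rewrite ?mulr_ge0.
- move=> i j ij; rewrite /particle_rate ij eqxx mulr_gt0//.
  rewrite ltr0n subn_gt0.
  by rewrite -ltnS -ij.
- by move=> i j; apply: particle_rate_reversible; rewrite gt_eqF.
- move=> t t0; rewrite -[RHS](tf_sum1 tf_p x (ltW t0)).
  transitivity (\sum_y p t x y * 1); last first.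
    by apply: eq_bigr => y _; rewrite mulr1.
  rewrite (partition_big_fst _ (fun=> 1)).
  by apply: eq_bigr => i _; rewrite mulr1.
(* The forward equation for the indicator of [i] particles: its generator depends on the state only
   through the count, so the sum regroups by counts. *)
- move=> t i t0.
  apply: (is_derive_eq
    (forward_equation tf_p rates_p (fun y => (y.1 == i)%:R) x t0)).
  rewrite -(partition_big_fst _ (fun m => \sum_j particle_rate lambda mu m j *
    ((j == i)%:R - (m == i)%:R))).
  apply: eq_bigr => y _; congr (_ * _).
  exact: (ehrenfest_rate_lump _ _ _ (fun j => (j == i)%:R - (y.1 == i)%:R)).
Qed.

Theorem proposition4p1 (R : realType) (disp : measure_display)
    (Omega : measurableType disp) (P : probability Omega R)
    (N d : nat) (lambda mu : R) (C : 'M[R]_d) (l0 : 'I_d)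
    (X : R -> Omega -> ehrenfest_state N d) (z : R) :
  0 < lambda -> 0 < mu -> stochastic_matrix C ->
  ehrenfest_process lambda mu C P l0 X ->
  0 < z -> z <= 1 ->
  let rho := lambda / mu in
  let g := (hyp2F1 (- N%:R) 1 (1 + N%:R) (- rho))^-1 in
  ('E_P[fun w => (z ^+ particles X t w)%R])%E @[t --> +oo%R] -->
  ((1 + rho * z) ^+ (2 * N) / (z ^+ N * (1 + rho) ^+ (2 * N)) *
   (1 + g * \sum_(j < N)
      'C(N, j.+1)%:R * ((z - 1) / (1 + rho * z)) ^+ j.+1 *
      hyp2F1 (- N%:R) j.+1%:R j.+2%:R (rho * (z - 1) / (1 + rho * z))))%:E.
Proof.
move=> lambda0 mu0 CS XE z0 _ rho g.
have rho0 : 0 < rho by rewrite divr_gt0.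
(* The closed form is traded for the stationary generating function, a finite sum in which the limit
   is taken term by term. *)
rewrite ehrenfest_pgf//.
have mX : forall t x, 0 <= t -> measurable [set w | X t w = x] by case: XE.
have [p [tf_p rates_p pX]] := markov_chain_marginal XE.
have E (t : R) : 0 <= t -> ('E_P[fun w => (z ^+ particles X t w)%R])%E =
    (\sum_(k < N.+1) (\sum_y p t (ord0, l0) y * (y.1 == k)%:R) * z ^+ k)%:E.
  move=> t0.
  rewrite (expectation_finite P (fun y => mX t y t0)
    (f := fun y => z ^+ nat_of_ord y.1)); last first.
    by move=> y; rewrite exprn_ge0 ?ltW.
  rewrite -(partition_big_fst _ (fun k : 'I_N.+1 => z ^+ k)) -sumEFin.
  by apply: eq_bigr => y _; rewrite pX// -EFinM mulrC.
have lim : (\sum_(k < N.+1)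
      (\sum_y p t (ord0, l0) y * (y.1 == k)%:R) * z ^+ k)%:E @[t --> +oo] -->
    ((\sum_(k < N.+1) ehrenfest_weight N rho k * z ^+ k) /
      (\sum_(k < N.+1) ehrenfest_weight N rho k))%:E.
  apply: cvg_EFin; first by near=> t.
  rewrite mulr_suml; apply: cvg_sumr => k.
  rewrite mulrAC; apply: cvgMl.
  exact: ehrenfest_particles_cvg rates_p.
apply: cvg_trans lim; apply: near_eq_cvg; near=> t.
by rewrite E//; near: t; exact: nbhs_pinfty_ge.
Unshelve. all: by end_near. Qed.
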